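(* Let $D$ be a long virtual knot diagram. For every $a\in X$ there exists a unique $(X;\underline{\triangleright},\overline{\triangleright})$-coloring $\mathcal{C}_a$ of $D$ such that the element assigned to the initial semiarc of $D$ is $a$. Moreover, there exists an element $F_D(s,u,t)\in X$, independent of $a$, such that for every $a\in X$ the element assigned to the terminal semiarc of $D$ by $\mathcal{C}_a$ is $F_D(s,u,t)\cdot a$.
   Context: Ring $X$. Let $\mathbb{Z}\langle s,s^{-1},u,t\rangle$ be the free non-commutative unital $\mathbb{Z}$-algebra on the four letters $s,s^{-1},u,t$, graded by $\deg(s)=\deg(s^{-1})=0$, $\deg(u)=\deg(t)=1$. Let $R$ be its degree completion: elements are formal sums $\sum_{d\ge 0}r_d$ with $r_d$ a finite $\mathbb{Z}$-linear combination of words of degree $d$. For $k\ge 0$ let $G^k\subset R$ be the two-sided ideal of elements involving only monomials of degree $\ge k$; the $G^k$ define the topology of $R$. For $A\in G^1$, $(1-A)^{-1}$ denotes $1+A+A^2+\cdots$. Let $J$ be the closure of the two-sided ideal of $R$ generated by $ss^{-1}-1$, $s^{-1}s-1$, $su-us$ and $sts^{-1}-(1-u)t(1+t)^{-1}$. Set $X=R/J$, and use the same letters for the images of $s,s^{-1},u,t$. Biquandle operations on $X$: $x\,\underline{\triangleright}\,y=s^{-1}x-s^{-1}(u+t)y$ and $x\,\overline{\triangleright}\,y=s^{-1}(1-u)x-s^{-1}t\,y$. Long virtual knot diagrams. A long virtual knot diagram is a smooth immersion $\phi:\mathbb{R}\to\mathbb{R}^2$ with $\phi(x)=(x,0)$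 for $|x|$ large, all of whose self-intersections are transverse double points, each endowed with either a classical crossing structure (a choice of over- and underpass) or a virtual crossing structure. It is oriented by the standard orientation of $\mathbb{R}$. A classical crossing is positive if (direction of overstrand, direction of understrand) is a positively oriented basis of $\mathbb{R}^2$, and negative otherwise. Semiarcs are the segments of the diagram between consecutive passages through classical crossings (and $\pm\infty$); virtual crossings do not cut semiarcs. The initial (terminal) semiarc is the one coming from $-\infty$ (going to $+\infty$). Coloring. An $(X;\underline{\triangleright},\overline{\triangleright})$-coloring of $D$ assigns an element of $X$ to each semiarc so that at each classical crossing, writing $o_{in},o_{out}$ for the colors of the incoming and outgoing over-semiarcs and $u_{in},u_{out}$ for those of the incoming and outgoing under-semiarcs: at a positive crossing, $o_{in}=o_{out}\,\overline{\triangleright}\,u_{in}$ and $u_{out}=u_{in}\,\underline{\triangleright}\,o_{out}$, equivalently $o_{out}=s(1-u)^{-1}o_{in}+(1-u)^{-1}t\,u_{in}$ and $u_{out}=s^{-1}(1+t)(1-u)^{-1}(1-u-t)u_{in}-(1-u-t)^{-1}(u+t)o_{in}$; at a negative crossing, $o_{out}=o_{in}\,\overline{\triangleright}\,u_{out}$ and $u_{in}=u_{out}\,\underline{\triangleright}\,o_{in}$, equivalently $u_{out}=s\,u_{in}+(u+t)o_{in}$ and $o_{out}=s^{-1}(1+t)(1-u-t)o_{in}-(1-u-t)^{-1}t\,u_{in}$. *)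

(* Defs.v *)
From HB Require Import structures.
From mathcomp Require Import all_boot all_order all_algebra generic_quotient.
From mathcomp Require Import all_classical all_reals topology normedtype.
From mathcomp Require Import derive.

Set Implicit Arguments.
Unset Strict Implicit.
Unset Printing Implicit Defensive.

Import Order.TTheory GRing.Theory Num.Theory.
Import numFieldNormedType.Exports.

Local Open Scope classical_set_scope.
Local Open Scope ring_scope.

(* [LSi] is the formal letter s^-1, which is unrelated to s in the free
   algebra. *)
Inductive letter := LS | LSi | LU | LT.

Definition letter_code (l : letter) : bool * bool :=
  match l with
  | LS => (false, false) | LSi => (false, true)
  | LU => (true, false) | LT => (true, true)
  end.

Definition letter_decode (p : bool * bool) : letter :=
  match p with
  | (false, false) => LS | (false, true) => LSi
  | (true, false) => LU | (true, true) => LT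
  end.

Lemma letter_codeK : cancel letter_code letter_decode.
Proof. by case. Qed.

HB.instance Definition _ := Equality.copy letter (can_type letter_codeK).

Notation word := (seq letter).

Definition wdeg (w : word) : nat := count (fun l => l \in [:: LU; LT]) w.

Definition finitary (f : word -> int) :=
  forall d, exists e : seq word, forall w, wdeg w = d -> f w != 0 -> w \in e.

(* The formal sum of the (f w) w over all words w; its component of degree d is
   the sum over the words of degree d, which is finite by [finitary]. *)
Record series := Series { scoef :> word -> int; scoefP : finitary scoef }.

HB.instance Definition _ := gen_eqMixin series.
HB.instance Definition _ := gen_choiceMixin series.

Lemma seriesP (f g : series) : scoef f =1 scoef g -> f = g.
Proof.
case: f g => [f fP] [g gP] /= /funext fg; subst g.
by congr Series; exact: Prop_irrelevance.
Qed.

Lemma finitary_le (f : word -> int) : finitary f ->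
  forall d, exists e : seq word,
    forall w, (wdeg w <= d)%N -> f w != 0 -> w \in e.
Proof.
move=> fP; elim=> [|d [e eP]].
  have [e eP] := fP 0%N; exists e => w.
  by rewrite leqn0 => /eqP; exact: eP.
have [e' eP'] := fP d.+1; exists (e ++ e') => w.
rewrite leq_eqVlt mem_cat ltnS => /orP[/eqP wd|wd] fw.
  by rewrite eP' ?orbT.
by rewrite eP.
Qed.

Lemma finitary_sub (f : word -> int) (e : seq word) :
  (forall w, f w != 0 -> w \in e) -> finitary f.
Proof. by move=> eP d; exists e => w _; exact: eP. Qed.

Lemma finitary0 : finitary (fun=> 0).
Proof. by apply: (@finitary_sub _ [::]) => w; rewrite eqxx. Qed.

Lemma finitaryN (f : word -> int) : finitary f -> finitary (fun w => - f w).
Proof.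
by move=> fP d; have [e eP] := fP d; exists e => w wd; rewrite oppr_eq0; exact: eP.
Qed.

Lemma finitaryD (f g : word -> int) :
  finitary f -> finitary g -> finitary (fun w => f w + g w).
Proof.
move=> fP gP d; have [e eP] := fP d; have [e' eP'] := gP d.
exists (e ++ e') => w wd; rewrite mem_cat.
have [fw|fw] := eqVneq (f w) 0; last by rewrite eP.
by rewrite fw add0r => gw; rewrite eP' ?orbT.
Qed.

Lemma wdeg_cat w1 w2 : wdeg (w1 ++ w2) = (wdeg w1 + wdeg w2)%N.
Proof. exact: count_cat. Qed.

Definition convol (f g : word -> int) (w : word) : int :=
  \sum_(i < (size w).+1) f (take i w) * g (drop i w).

Lemma finitaryM (f g : word -> int) :
  finitary f -> finitary g -> finitary (convol f g).
Proof.
move=> fP gP d.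
have [e eP] := finitary_le fP d; have [e' eP'] := finitary_le gP d.
exists [seq w1 ++ w2 | w1 <- e, w2 <- e'] => w wd.
apply: contraNT => we; apply/eqP; rewrite /convol big1// => i _.
have [fw|fw] := eqVneq (f (take i w)) 0; first by rewrite fw mul0r.
have [gw|gw] := eqVneq (g (drop i w)) 0; first by rewrite gw mulr0.
case/negP: we; rewrite -(cat_take_drop i w).
move: wd; rewrite -{1}(cat_take_drop i w) wdeg_cat => wd.
apply: allpairs_f; [apply: eP => //|apply: eP' => //]; rewrite -wd.
  exact: leq_addr.
exact: leq_addl.
Qed.

Lemma finitary_word (v : word) : finitary (fun w => (w == v)%:R).
Proof.
apply: (@finitary_sub _ [:: v]) => w.
by rewrite inE; case: (w == v) => //; rewrite eqxx.
Qed.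

Definition zero_series := Series finitary0.
Definition opp_series (f : series) := Series (finitaryN (scoefP f)).
Definition add_series (f g : series) := Series (finitaryD (scoefP f) (scoefP g)).
Definition mul_series (f g : series) := Series (finitaryM (scoefP f) (scoefP g)).
Definition word_series (v : word) := Series (finitary_word v).

Lemma add_seriesA : associative add_series.
Proof. by move=> f g h; apply: seriesP => w /=; rewrite addrA. Qed.
Lemma add_seriesC : commutative add_series.
Proof. by move=> f g; apply: seriesP => w /=; rewrite addrC. Qed.
Lemma add0_series : left_id zero_series add_series.
Proof. by move=> f; apply: seriesP => w /=; rewrite add0r. Qed.
Lemma addN_series : left_inverse zero_series opp_series add_series.
Proof. by move=> f; apply: seriesP => w /=; rewrite addNr. Qed.

HB.instance Definition _ := GRing.isZmodule.Build series
  add_seriesA add_seriesC add0_series addN_series.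

Lemma convol_nil f g : convol f g [::] = f [::] * g [::].
Proof. by rewrite /convol big_ord_recl big_ord0 addr0. Qed.

Lemma convol_cons f g l w :
  convol f g (l :: w) = f [::] * g (l :: w) + convol (fun v => f (l :: v)) g w.
Proof. by rewrite /convol big_ord_recl. Qed.

Lemma convolDl f g h w :
  convol (fun v => f v + g v) h w = convol f h w + convol g h w.
Proof. by rewrite /convol -big_split; apply: eq_bigr => i _; rewrite mulrDl. Qed.

Lemma convolDr f g h w :
  convol f (fun v => g v + h v) w = convol f g w + convol f h w.
Proof. by rewrite /convol -big_split; apply: eq_bigr => i _; rewrite mulrDr. Qed.

Lemma convolZl a f g w : convol (fun v => a * f v) g w = a * convol f g w.
Proof. by rewrite /convol mulr_sumr; apply: eq_bigr => i _; rewrite mulrA. Qed.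

Lemma eq_convoll f f' g w : f =1 f' -> convol f g w = convol f' g w.
Proof. by move=> ff'; apply: eq_bigr => i _; rewrite ff'. Qed.

Lemma convolA f g h w : convol f (convol g h) w = convol (convol f g) h w.
Proof.
elim: w f => [|l w IHw] f; first by rewrite !convol_nil mulrA.
rewrite !convol_cons IHw convol_nil mulrDr -!addrA mulrA; congr (_ + _).
rewrite [RHS](@eq_convoll _ (fun v => f [::] * g (l :: v) +
  convol (fun u => f (l :: u)) g v)); last by move=> v; rewrite convol_cons.
by rewrite convolDl convolZl.
Qed.

Lemma convol0l g w : convol (fun=> 0) g w = 0.
Proof. by rewrite /convol big1// => i _; rewrite mul0r. Qed.

Lemma mul_seriesA : associative mul_series.
Proof. by move=> f g h; apply: seriesP => w; exact: convolA. Qed.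

Lemma mul1_series : left_id (word_series [::]) mul_series.
Proof.
move=> f; apply: seriesP => -[|l w]; first by rewrite /= convol_nil mul1r.
by rewrite /= convol_cons mul1r (@eq_convoll _ (fun=> 0))// convol0l addr0.
Qed.

Lemma mul_series1 : right_id (word_series [::]) mul_series.
Proof.
move=> f; apply: seriesP => w /=; rewrite /convol big_ord_recr /=.
rewrite drop_size take_size eqxx mulr1 big1 ?add0r// => i _.
by rewrite -size_eq0 size_drop subn_eq0 leqNgt ltn_ord mulr0.
Qed.

Lemma mul_seriesDl : left_distributive mul_series add_series.
Proof. by move=> f g h; apply: seriesP => w; exact: convolDl. Qed.

Lemma mul_seriesDr : right_distributive mul_series add_series.
Proof. by move=> f g h; apply: seriesP => w; exact: convolDr. Qed.

HB.instance Definition _ := GRing.Zmodule_isPzRing.Build series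
  mul_seriesA mul1_series mul_series1 mul_seriesDl mul_seriesDr.

Definition G (k : nat) : set series :=
  [set f | forall w, (wdeg w < k)%N -> scoef f w = 0].

(* (1 - A)^-1 = 1 + A + A^2 + ... for A in G 1: as A ^+ i is in G i, only the
   A ^+ i with i <= wdeg w contribute to the coefficient of w. *)
Definition geom_coef (A : series) (w : word) : int :=
  \sum_(i < (wdeg w).+1) scoef (A ^+ i) w.

Lemma finitary_sum n (f : nat -> word -> int) :
  (forall i, finitary (f i)) -> finitary (fun w => \sum_(i < n) f i w).
Proof.
move=> fP; elim: n => [|n IHn].
  by apply: (@finitary_sub _ [::]) => w; rewrite big_ord0 eqxx.
move=> d; have [e eP] := finitaryD IHn (fP n) d; exists e => w wd.
by rewrite big_ord_recr; exact: eP.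
Qed.

Lemma finitary_geom (A : series) : finitary (geom_coef A).
Proof.
move=> d.
have [e eP] := @finitary_sum d.+1 (fun i => scoef (A ^+ i))
  (fun i => scoefP (A ^+ i)) d.
by exists e => w wd; rewrite /geom_coef wd; exact: eP.
Qed.

Definition geom (A : series) : series := Series (finitary_geom A).

Lemma G_mul j k (f g : series) : G j f -> G k g -> G (j + k) (f * g).
Proof.
move=> fj gk w wjk; rewrite [LHS]/(convol _ _ _) /convol big1// => i _.
have [/fj ->|jw] := ltnP (wdeg (take i w)) j; first by rewrite mul0r.
rewrite gk ?mulr0//; move: wjk.
rewrite -{1}(cat_take_drop i w) wdeg_cat => wjk.
by rewrite -(ltn_add2l j) (leq_ltn_trans _ wjk)// leq_add2r.
Qed.

Lemma G_exp (A : series) : G 1 A -> forall n, G n (A ^+ n).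
Proof.
move=> A1; elim=> [|n IHn]; first by move=> w; rewrite ltn0.
by rewrite exprS -add1n; exact: G_mul.
Qed.

Lemma scoefD (f g : series) w : scoef (f + g) w = scoef f w + scoef g w.
Proof. by []. Qed.

Lemma scoefN (f : series) w : scoef (- f) w = - scoef f w.
Proof. by []. Qed.

Lemma scoef_sum n (f : nat -> series) w :
  scoef (\sum_(i < n) f i) w = \sum_(i < n) scoef (f i) w.
Proof.
elim: n => [|n IHn]; first by rewrite !big_ord0.
by rewrite !big_ord_recr /= IHn.
Qed.

Lemma geom_approx (A : series) : G 1 A ->
  forall n, G n (geom A - \sum_(i < n) A ^+ i).
Proof.
move=> A1 n w wn.
rewrite scoefD scoefN (scoef_sum n (fun i => A ^+ i)).
rewrite [scoef (geom A) w]/(geom_coef A w) /geom_coef.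
rewrite -(big_mkord xpredT (fun i => scoef (A ^+ i) w)).
rewrite -(big_mkord xpredT (fun i => scoef (A ^+ i) w)).
rewrite (big_cat_nat (n := (wdeg w).+1) (p := n))//= opprD addrA subrr add0r.
rewrite big_nat_cond big1 ?oppr0// => i /andP[/andP[wi _] _].
exact: (G_exp A1).
Qed.

Lemma G_add k (f g : series) : G k f -> G k g -> G k (f + g).
Proof. by move=> fk gk w wk; rewrite scoefD fk ?gk// addr0. Qed.

Lemma G_opp k (f : series) : G k f -> G k (- f).
Proof. by move=> fk w wk; rewrite scoefN fk// oppr0. Qed.

Lemma G_mulW k (f g h : series) : G k g -> G k (f * g * h).
Proof.
move=> gk; have G0 (x : series) : G 0 x by move=> w; rewrite ltn0.
by rewrite -(add0n k) -(addn0 (0 + k)%N); do 2![apply: G_mul => //].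
Qed.

Lemma geomK (A : series) : G 1 A -> (1 - A) * geom A = 1.
Proof.
move=> A1; apply/subr0_eq/seriesP => w; set n := (wdeg w).+1.
suff : G n ((1 - A) * geom A - 1) by apply.
rewrite -[X in _ * X](subrK (\sum_(i < n) A ^+ i)) mulrDr -addrA.
apply: G_add; first by rewrite -[_ * _]mulr1; exact/G_mulW/geom_approx.
have -> : (1 - A) * (\sum_(i < n) A ^+ i) = 1 - A ^+ n.
  by rewrite -opprB mulNr -subrX1 opprB.
by rewrite addrAC subrr add0r; apply: G_opp; exact: G_exp.
Qed.

Definition Rs : series := word_series [:: LS].
Definition Rsi : series := word_series [:: LSi].
Definition Ru : series := word_series [:: LU].
Definition Rt : series := word_series [:: LT].

Definition two_sided_ideal (A : pzRingType) (I : set A) :=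
  [/\ I 0, forall x y, I x -> I y -> I (x - y) &
      forall a x b, I x -> I (a * x * b)].
Arguments two_sided_ideal {A} I.

Definition relators : set series :=
  [set Rs * Rsi - 1; Rsi * Rs - 1; Rs * Ru - Ru * Rs;
       Rs * Rt * Rsi - (1 - Ru) * Rt * geom (- Rt)].

(* Closure for the topology in which the f + G k, for k : nat, form a basis of
   neighbourhoods of f. *)
Definition G_closure (I : set series) : set series :=
  [set f | forall k, exists2 g, I g & G k (f - g)].

Definition J : set series := G_closure (smallest two_sided_ideal relators).

Lemma smallest_two_sided (A : pzRingType) (S : set A) :
  two_sided_ideal (smallest two_sided_ideal S).
Proof.
split=> [I [[]]//|x y Ix Iy I [II SI]|a x b Ix I [II SI]]; case: (II) => _ IB IM.
  by apply: IB; [exact: Ix|exact: Iy].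
by apply: IM; exact: Ix.
Qed.

Lemma J_two_sided : two_sided_ideal J.
Proof.
have [I0 IB IM] := smallest_two_sided relators.
split=> [k|x y Jx Jy k|a x b Jx k].
- by exists 0 => //; rewrite subr0 => w _.
- have [f If xf] := Jx k; have [g Ig yg] := Jy k.
  exists (f - g); first exact: IB.
  by rewrite opprD addrACA -opprD; apply: G_add => //; exact: G_opp.
- have [f If xf] := Jx k; exists (a * f * b); first exact: IM.
  by rewrite -mulrBl -mulrBr; exact: G_mulW.
Qed.

Definition Jpred : series -> bool := fun f => `[< J f >].

Lemma Jpred_zmod_closed : zmod_closed Jpred.
Proof.
have [J0 JB _] := J_two_sided.
by split=> [|x y /asboolP Jx /asboolP Jy]; apply/asboolP => //; exact: JB.
Qed.

HB.instance Definition _ := GRing.isZmodClosed.Build series Jpred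
  Jpred_zmod_closed.

Definition X := Quotient.quot (GRing.ZmodClosed.clone series Jpred _).

HB.instance Definition _ := GRing.Zmodule.on X.

Definition projX (f : series) : X := \pi_X%qT f.

Lemma projXP f g : projX f = projX g <-> J (f - g).
Proof.
split=> [/eqP|Jfg]; first by rewrite -Quotient.idealrBE => /asboolP.
by apply/eqP; rewrite -Quotient.idealrBE; apply/asboolP.
Qed.

Lemma projX_repr (x : X) : projX (repr x) = x.
Proof. exact: reprK. Qed.

Lemma projXD f g : projX (f + g) = projX f + projX g.
Proof. by rewrite /projX !piE. Qed.

Definition oneX : X := projX 1.
Definition mulX (x y : X) : X := projX (repr x * repr y).

Lemma projXM f g : projX (f * g) = mulX (projX f) (projX g).
Proof.
have [J0 JB JM] := J_two_sided.
have JN x : J x -> J (- x) by move=> Jx; rewrite -sub0r; exact: JB.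
have Jf : J (f - repr (projX f)) by apply/projXP; rewrite projX_repr.
have Jg : J (g - repr (projX g)) by apply/projXP; rewrite projX_repr.
apply/projXP; set f' := repr _; set g' := repr _.
have -> : f * g - f' * g' = 1 * (f - f') * g - (- f') * (g - g') * 1.
  by rewrite mul1r mulr1 mulNr opprK mulrBl mulrBr addrA subrK.
by apply: JB; exact: JM.
Qed.

Lemma mulXA : associative mulX.
Proof.
move=> x y z; rewrite -[x]projX_repr -[y]projX_repr -[z]projX_repr.
by rewrite -!projXM mulrA.
Qed.

Lemma mul1X : left_id oneX mulX.
Proof. by move=> x; rewrite -[x]projX_repr -projXM mul1r. Qed.

Lemma mulX1 : right_id oneX mulX.
Proof. by move=> x; rewrite -[x]projX_repr -projXM mulr1. Qed.

Lemma mulXDl : left_distributive mulX +%R.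
Proof.
move=> x y z; rewrite -[x]projX_repr -[y]projX_repr -[z]projX_repr.
by rewrite -!(projXD, projXM) mulrDl.
Qed.

Lemma mulXDr : right_distributive mulX +%R.
Proof.
move=> x y z; rewrite -[x]projX_repr -[y]projX_repr -[z]projX_repr.
by rewrite -!(projXD, projXM) mulrDr.
Qed.

HB.instance Definition _ := GRing.Zmodule_isPzRing.Build X
  mulXA mul1X mulX1 mulXDl mulXDr.

Definition Xs : X := projX Rs.
Definition Xsi : X := projX Rsi.
Definition Xu : X := projX Ru.
Definition Xt : X := projX Rt.

Definition under_op (x y : X) : X := Xsi * x - Xsi * (Xu + Xt) * y.
Definition over_op (x y : X) : X := Xsi * (1 - Xu) * x - Xsi * Xt * y.

Section Curve.
Variables (K : realType) (phi : K -> K * K).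

Definition xcoord (r : K) : K := (phi r).1.
Definition ycoord (r : K) : K := (phi r).2.

Definition smooth (f : K -> K) := forall n r, derivable (f^`(n))%classic r 1.

Definition vel (r : K) : K * K := (xcoord^`()%classic r, ycoord^`()%classic r).

End Curve.

Definition det2 (K : realType) (v w : K * K) : K := v.1 * w.2 - v.2 * w.1.

(* [classical o v] says that the parameters o and v are the over- and the
   underpassage of a classical crossing; the virtual crossings are the double
   points phi a = phi b, a <> b, with neither [classical a b] nor
   [classical b a]. *)
Record diagram (K : realType) := Diagram {
  phi : K -> K * K;
  classical : K -> K -> Prop;
  phi_smooth : smooth (xcoord phi) /\ smooth (ycoord phi);
  phi_immersion : forall r, vel phi r <> (0, 0);
  phi_long : exists M : K, forall r, M < `|r| -> phi r = (r, 0);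
  phi_double : forall a b c, phi a = phi b -> phi b = phi c ->
    [\/ a = b, b = c | a = c];
  phi_transverse : forall a b, a <> b -> phi a = phi b ->
    det2 (vel phi a) (vel phi b) <> 0;
  classical_double : forall o v, classical o v -> o <> v /\ phi o = phi v;
  classical_asym : forall o v, classical o v -> ~ classical v o }.

Section Coloring.
Variables (K : realType) (D : diagram K).

Definition positive (o v : K) := 0 < det2 (vel (phi D) o) (vel (phi D) v).

Definition cut : set K :=
  [set r | exists r', classical D r r' \/ classical D r' r].

Record semiarc := Semiarc {
  start : \bar K;
  stop : \bar K;
  semiarc_lt : (start < stop)%E;
  semiarc_start : start = -oo%E \/ exists2 r, cut r & start = r%:E;
  semiarc_stop : stop = +oo%E \/ exists2 r, cut r & stop = r%:E;
  semiarc_uncut : forall r, cut r -> ~ (start < r%:E < stop)%E }.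

Variables (A : Type) (unop ovop : A -> A -> A) (C : semiarc -> A).

Definition is_coloring := forall o v, classical D o v ->
  exists oi oo ui uo : semiarc,
    [/\ stop oi = o%:E, start oo = o%:E, stop ui = v%:E, start uo = v%:E &
      if `[< positive o v >]
      then C oi = ovop (C oo) (C ui) /\ C uo = unop (C ui) (C oo)
      else C oo = ovop (C oi) (C uo) /\ C ui = unop (C uo) (C oi)].

Definition initial_color (a : A) := exists2 i : semiarc, start i = -oo%E & C i = a.
Definition terminal_color (a : A) := exists2 i : semiarc, stop i = +oo%E & C i = a.

End Coloring.

(* Main.v *)
Require Import Defs.
From mathcomp Require Import all_boot all_order all_algebra.
From mathcomp Require Import all_classical all_reals topology normedtype.
From mathcomp Require Import derive.

(* The colouring equations at the crossings express the colour of each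
   non-initial semiarc as a combination of the colour of the preceding semiarc
   on the line and of further colours with coefficients in the image of
   G^1 in X.  Since 1 - m is invertible for every m in that ideal
   (geometric series), this linear system, triangular modulo the ideal, has a
   unique solution once the initial colour a is fixed, by Gaussian elimination.
   The equations are linear with coefficients acting on the left, so the
   solution for a is the solution for 1 multiplied by a on the right, and F is
   the terminal colour of the solution for 1.
   That there are finitely many semiarcs follows from compactness: the double
   points of the diagram lie in a bounded square, and are isolated because the
   curve is an immersion with transverse self-intersections. *)

Set Implicit Arguments.
Unset Strict Implicit.
Unset Printing Implicit Defensive.

Import Order.TTheory GRing.Theory Num.Theory.
Import numFieldNormedType.Exports.

Local Open Scope classical_set_scope.
Local Open Scope ring_scope.

(** * Linear systems triangular modulo a quasi-regular ideal *)

Section TwoSidedIdeal.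
Variables (A : pzRingType) (I : set A).
Hypothesis idealI : two_sided_ideal I.

Lemma ideal0 : I 0. Proof. by case: idealI. Qed.

Lemma idealB x y : I x -> I y -> I (x - y).
Proof. by case: idealI => _ + _; apply. Qed.

Lemma idealN x : I x -> I (- x).
Proof. by move=> Ix; rewrite -sub0r; apply: idealB => //; exact: ideal0. Qed.

Lemma idealD x y : I x -> I y -> I (x + y).
Proof.
by move=> Ix Iy; rewrite -[y]opprK; apply: idealB => //; exact: idealN.
Qed.

Lemma idealMl a x : I x -> I (a * x).
Proof. by move=> Ix; rewrite -[_ * _]mulr1; case: idealI => _ _; apply. Qed.

Lemma idealMr x a : I x -> I (x * a).
Proof. by move=> Ix; rewrite -[x]mul1r; case: idealI => _ _; apply. Qed.

End TwoSidedIdeal.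

(* For a two-sided ideal: being contained in the Jacobson radical. *)
Definition quasi_regular (A : pzRingType) (I : set A) :=
  forall m, I m -> exists b, (1 - m) * b = 1 /\ b * (1 - m) = 1.

(** The system x = b + M x. Indexing by [nat] lets the last unknown be dropped without a change of
    type. *)
Definition solution (A : pzRingType) (n : nat) (M : nat -> nat -> A)
    (b x : nat -> A) :=
  forall i, (i < n)%N -> x i = b i + \sum_(j < n) M i j * x j.

Lemma eq_solution (A : pzRingType) n M (b x y : nat -> A) :
  (forall i, (i < n)%N -> x i = y i) -> solution n M b x -> solution n M b y.
Proof.
move=> xy sx i i_n; rewrite -xy// sx//; congr (_ + _).
by apply: eq_bigr => k _; rewrite xy.
Qed.

(** The coefficients act on the left, so they commute with right multiplication by [a]. *)
Lemma solutionMr (A : pzRingType) n M (b x : nat -> A) a :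
  solution n M b x -> solution n M (fun i => b i * a) (fun i => x i * a).
Proof.
move=> sx i i_n; rewrite sx// mulrDl mulr_suml; congr (_ + _).
by apply: eq_bigr => k _; rewrite mulrA.
Qed.

(* Eliminating the last unknown keeps the coefficients on and above the diagonal
   in I. *)
Lemma solution_unique_exists (A : pzRingType) (I : set A) :
  two_sided_ideal I -> quasi_regular I ->
  forall n M b, (forall i j, (i <= j < n)%N -> I (M i j)) ->
  (exists x, solution n M b x) /\
  (forall x y, solution n M b x -> solution n M b y ->
     forall i, (i < n)%N -> x i = y i).
Proof.
move=> idI qI; elim=> [|n IHn] M b MI; first by split=> //; exists (fun=> 0).
have [c [Mc cM]] := qI _ (MI n n (introT andP (conj (leqnn n) (leqnn n.+1)))).
(* Schur complement: the last unknown is substituted into the other rows, [c] being the inverse of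
   [1 - M n n]. *)
pose M' i j := M i j + M i n * c * M n j.
pose b' i := b i + M i n * c * b n.
have M'I i j : (i <= j < n)%N -> I (M' i j).
  move=> /andP[ij jn]; apply: idealD => //; first by apply: MI; rewrite ij ltnW.
  do 2![apply: idealMr => //]; apply: MI.
  by rewrite (leq_trans ij (ltnW jn)) leqnn.
have [[x xP] uniq] := IHn M' b' M'I.
(* This direction uses the left inverse of [1 - M n n]; checking the last equation for [z] below
   uses the right inverse. *)
have last_eq y : solution n.+1 M b y ->
    y n = c * (b n + \sum_(j < n) M n j * y j).
  move=> /(_ n (leqnn _)); rewrite big_ord_recr /= addrA => yn.
  by rewrite -[LHS]mul1r -cM -mulrA mulrBl mul1r {1}yn addrK.
have reduce y : y n = c * (b n + \sum_(j < n) M n j * y j) -> forall i,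
    b i + \sum_(j < n.+1) M i j * y j = b' i + \sum_(j < n) M' i j * y j.
  move=> yn i; rewrite big_ord_recr /= yn /b' !mulrDr -!addrA; congr (_ + _).
  rewrite addrCA !mulrA; congr (_ + _).
  rewrite !mulr_sumr -big_split; apply: eq_bigr => j _ /=.
  by rewrite mulrDl !mulrA.
split.
- pose z := c * (b n + \sum_(j < n) M n j * x j).
  pose y i := if i == n then z else x i.
  have yx (f : nat -> A) : \sum_(j < n) f j * y j = \sum_(j < n) f j * x j.
    by apply: eq_bigr => j _; rewrite /y ltn_eqF.
  have yn : y n = c * (b n + \sum_(j < n) M n j * y j).
    by rewrite yx /y eqxx.
  exists y => i; rewrite ltnS leq_eqVlt => /orP[/eqP ->|i_n].
    rewrite big_ord_recr /= addrA.
    apply/eqP; rewrite -subr_eq -[X in X - _]mul1r -mulrBl yn mulrA Mc.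
    by rewrite mul1r.
  by rewrite reduce// yx {1}/y ltn_eqF//; exact: xP.
- move=> y z ys zs.
  have sub w : solution n.+1 M b w -> solution n M' b' w.
    move=> ws i i_n; rewrite -reduce; last exact: last_eq.
    by apply: ws; exact: ltnW.
  have yz := uniq _ _ (sub y ys) (sub z zs).
  move=> i; rewrite ltnS leq_eqVlt => /orP[/eqP ->|]; last exact: yz.
  rewrite (last_eq y)// (last_eq z)//; congr (_ * (_ + _)).
  by apply: eq_bigr => j _; rewrite yz.
Qed.

(** * The image of G^1 in X *)

Definition aug : set X := projX @` G 1.

Lemma projX0 : projX 0 = 0.
Proof. by apply: (addrI (projX 0)); rewrite -projXD !addr0. Qed.

Lemma projXN f : projX (- f) = - projX f.
Proof. by apply: (addrI (projX f)); rewrite -projXD !subrr projX0. Qed.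

Lemma projX1 : projX 1 = 1. Proof. by []. Qed.

Lemma projX_mul f g : projX (f * g) = projX f * projX g.
Proof. exact: projXM. Qed.

Lemma ideal_aug : two_sided_ideal aug.
Proof.
split=> [|_ _ [f f1 <-] [g g1 <-]|a _ b [f f1 <-]].
- by exists 0; [move=> w _|rewrite projX0].
- exists (f - g); last by rewrite projXD projXN.
  by apply: G_add => //; exact: G_opp.
- exists (repr a * f * repr b); first exact: G_mulW.
  by rewrite !projX_mul !projX_repr.
Qed.

(** By [geomK], [geom A] has the left inverse [1 - A]. It also equals 1 - B with B = [1 - geom A] in
    [G 1], so [geom B] is a right inverse, and the two coincide. *)
Lemma geom_inv (A : series) : G 1 A -> geom A * (1 - A) = 1.
Proof.
move=> A1; have B1 : G 1 (1 - geom A).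
  have := geom_approx A1 (n := 1); rewrite big_ord_recl big_ord0 expr0 addr0.
  by rewrite -[1 - _]opprB; exact: G_opp.
have := geomK B1; rewrite opprB addrC subrK => gK.
suff -> : 1 - A = geom (1 - geom A) by [].
by rewrite -[LHS]mulr1 -[X in _ * X]gK mulrA geomK// mul1r.
Qed.

Lemma quasi_regular_aug : quasi_regular aug.
Proof.
move=> _ [f f1 <-]; exists (projX (geom f)).
have -> : 1 - projX f = projX (1 - f) by rewrite projXD projXN.
by split; rewrite -projX_mul ?geomK ?geom_inv.
Qed.

Lemma aug_u : aug Xu.
Proof. by exists Ru => // -[|[] w]. Qed.

Lemma aug_t : aug Xt.
Proof. by exists Rt => // -[|[] w]. Qed.

Lemma XsK : Xs * Xsi = 1.
Proof.
rewrite -projX_mul -projX1; apply/projXP => k.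
exists (Rs * Rsi - 1); last by rewrite subrr => w _.
by move=> I [_]; apply; left; left; left.
Qed.

Lemma XsiK : Xsi * Xs = 1.
Proof.
rewrite -projX_mul -projX1; apply/projXP => k.
exists (Rsi * Rs - 1); last by rewrite subrr => w _.
by move=> I [_]; apply; left; left; right.
Qed.

Lemma XsiP x y : x = Xsi * y <-> Xs * x = y.
Proof. by split=> [->|<-]; rewrite mulrA ?XsK ?XsiK mul1r. Qed.

(** Leaving [x] on the right with coefficient [Xu] avoids inverting 1 - u: [x] is [Xs * z] plus
    terms with coefficients in [aug]. *)
Lemma over_opP x y z : z = over_op x y <-> x = Xs * z + Xu * x + Xt * y.
Proof.
have -> : over_op x y = Xsi * (x - Xu * x - Xt * y).
  by rewrite /over_op !mulrBr mulr1 mulrBl !mulrA.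
rewrite XsiP; split=> [->|xE]; first by rewrite addrAC !addrNK.
by rewrite {1}xE [X in X - _]addrAC !addrK.
Qed.

Lemma under_opP x y z : z = under_op x y <-> x = Xs * z + (Xu + Xt) * y.
Proof.
rewrite /under_op -!mulrA -mulrBr XsiP.
by split=> [->|->]; rewrite ?addrNK ?addrK.
Qed.

(** * Finiteness of the set of double points *)

Lemma compact_isolated_finite (T : topologicalType) (A Z : set T) :
  compact A -> (forall p, A p -> exists2 U, nbhs p U & finite_set (U `&` Z)) ->
  finite_set (A `&` Z).
Proof.
move=> /compact_near_coveringP cA isol.
(* A property holds near [F] when it holds for all sets containing some fixed finite set. The
   near-covering form of compactness thus merges the local finite sets into one finite set
   containing [A] intersected with [Z]. *)
pose F : set_system (set T) :=
  filter_from [set W | finite_set W] (fun W => [set V | W `<=` V]).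
have FF : Filter F.
  apply: filter_from_filter; first by exists set0; exact: finite_set0.
  move=> V W finV finW; exists (V `|` W); first by rewrite /= finite_setU.
  by move=> S /= VWS; split=> x ?; apply: VWS; [left|right].
have [p /isol[U pU finU]|W finW WP] := cA _ F (fun V x => Z x -> V x) FF.
  exists (U, [set V | U `&` Z `<=` V]); first by split=> //; exists (U `&` Z).
  by move=> [x V] [/= Ux UZV] Zx; apply: UZV.
by apply: sub_finite_set finW => x [Ax Zx]; exact: (WP W).
Qed.

(** * Local injectivity and isolated crossings of smooth plane curves *)

Section PlaneCurve.
Variable K : realType.
Implicit Types (f x y : K -> K) (p q : K).

Lemma smooth_derivable f : smooth f -> forall r, derivable f r 1.
Proof. by move=> /(_ 0%N). Qed.

Lemma smooth_continuous f : smooth f -> continuous f.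
Proof.
move=> sf r.
exact/differentiable_continuous/derivable1_diffP/smooth_derivable.
Qed.

Lemma smooth_derive1_continuous f : smooth f -> continuous f^`()%classic.
Proof.
by move=> sf r; apply/differentiable_continuous/derivable1_diffP/(sf 1%N).
Qed.

Lemma MVT_ball f p e a b : (forall r, derivable f r 1) ->
  ball p e a -> ball p e b ->
  exists2 c, ball p e c & f a - f b = (f^`())%classic c * (a - b).
Proof.
move=> df; wlog ab : a b / b <= a => [hw|] pa pb.
  have /orP[|ba] := le_total b a; first by move/hw; apply.
  have [c pc fc] := hw b a ba pb pa.
  by exists c => //; rewrite -opprB fc -mulrN opprB.
have [||c cab fE] := @MVT_segment K f (f^`())%classic b a ab.
- by move=> c _; rewrite derive1E; exact/derivableP.
- apply: continuous_subspaceT => c.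
  exact/differentiable_continuous/derivable1_diffP.
exists c => //; move: pa pb cab; rewrite /ball /= !ltr_distlC in_itv /=.
move=> /andP[_ ape] /andP[pb _] /andP[bc ca].
by rewrite (lt_le_trans pb bc) (le_lt_trans ca ape).
Qed.

(** By the mean value theorem, [f a = f b] gives f'(c)(a - b) = 0 with c near [p], where f' does not
    vanish. *)
Lemma immersion_locally_injective f p : smooth f -> (f^`())%classic p != 0 ->
  exists2 U, nbhs p U & forall a b, U a -> U b -> f a = f b -> a = b.
Proof.
move=> sf fp0.
have : nbhs p [set r | (f^`())%classic r != 0].
  exact: cvgr_neq0 (@smooth_derive1_continuous f sf p) fp0.
move=> /nbhs_ballP[e e0 eP].
exists (ball p e); first exact: nbhsx_ballx.
move=> a b pa pb fab.
have [c pc] := MVT_ball (smooth_derivable sf) pa pb.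
move=> /eqP; rewrite fab subrr eq_sym mulf_eq0 (negPf (eP _ pc)) /= subr_eq0.
by move/eqP.
Qed.

(** The mean value theorem in each coordinate turns a nearby double point (a, b) into a homogeneous
    2 by 2 linear system for a - p and b - q, whose determinant is close to that of the velocities,
    hence non-zero. *)
Lemma transverse_isolated x y p q : smooth x -> smooth y ->
  x p = x q -> y p = y q ->
  x^`()%classic p * y^`()%classic q - y^`()%classic p * x^`()%classic q != 0 ->
  exists2 U, nbhs (p, q) U & forall a b, U (a, b) ->
    x a = x b -> y a = y b -> a = p /\ b = q.
Proof.
move=> sx sy xpq ypq det0.
set x' := (x^`())%classic in det0; set y' := (y^`())%classic in det0.
have cx : continuous x' by exact: smooth_derive1_continuous.
have cy : continuous y' by exact: smooth_derive1_continuous.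
(* The four intermediate points are unrelated, so the determinant is a function of four parameters,
   two near [p] and two near [q]. *)
pose det (z : (K * K) * (K * K)) := x' z.1.1 * y' z.2.2 - y' z.1.2 * x' z.2.1.
have cdet : det z @[z --> ((p, p), (q, q))] --> det ((p, p), (q, q)).
  have comp_cvg (f : K -> K) (g : K * K -> K)
      (h : (K * K) * (K * K) -> K * K) z :
      continuous f -> continuous g -> continuous h ->
      f (g (h w)) @[w --> z] --> f (g (h z)).
    move=> cf cg ch; apply: (@continuous_comp _ _ _ (g \o h) f); last exact: cf.
    by apply: continuous_comp; [exact: ch|exact: cg].
  have fst1 : continuous (@fst K K) by move=> z; exact: cvg_fst.
  have snd1 : continuous (@snd K K) by move=> z; exact: cvg_snd.
  have fst2 : continuous (@fst (K * K) (K * K)) by move=> z; exact: cvg_fst.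
  have snd2 : continuous (@snd (K * K) (K * K)) by move=> z; exact: cvg_snd.
  apply: cvgB; apply: cvgM.
  - exact: (comp_cvg _ _ _ _ cx fst1 fst2).
  - exact: (comp_cvg _ _ _ _ cy snd1 snd2).
  - exact: (comp_cvg _ _ _ _ cy snd1 fst2).
  - exact: (comp_cvg _ _ _ _ cx fst1 snd2).
have : nbhs ((p, p), (q, q)) [set z | det z != 0] by exact: cvgr_neq0 cdet det0.
move=> /nbhs_ballP[e e0 eP].
have {}eP a b c d : ball p e a -> ball p e b -> ball q e c -> ball q e d ->
    x' a * y' d - y' b * x' c != 0.
  by move=> pa pb qc qd; apply: (eP ((a, b), (c, d))).
exists (ball p e `*` ball q e).
  exists (ball p e, ball q e) => //; split; exact: nbhsx_ballx.
move=> a b [/= pa qb] xab yab.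
have pp : ball p e p by exact: ballxx.
have qq : ball q e q by exact: ballxx.
have [c1 pc1 xa] := MVT_ball (smooth_derivable sx) pa pp.
have [c2 pc2 xb] := MVT_ball (smooth_derivable sx) qb qq.
have [c3 pc3 ya] := MVT_ball (smooth_derivable sy) pa pp.
have [c4 pc4 yb] := MVT_ball (smooth_derivable sy) qb qq.
have := eP _ _ _ _ pc1 pc3 pc2 pc4.
rewrite -/x' -/y' in xa xb ya yb *.
have E1 : x' c1 * (a - p) = x' c2 * (b - q) by rewrite -xa -xb xab xpq.
have E2 : y' c3 * (a - p) = y' c4 * (b - q) by rewrite -ya -yb yab ypq.
move=> d0.
have /eqP : (x' c1 * y' c4 - y' c3 * x' c2) * (a - p) = 0.
  rewrite mulrBl mulrAC E1 [y' c3 * _ * _]mulrAC E2 mulrAC.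
  by rewrite [_ * _ * x' c2]mulrAC [y' c4 * _]mulrC subrr.
have /eqP : (x' c1 * y' c4 - y' c3 * x' c2) * (b - q) = 0.
  by rewrite mulrBl -mulrA -E2 -mulrA -E1 mulrCA subrr.
by rewrite !mulf_eq0 (negPf d0) /= !subr_eq0 => /eqP -> /eqP ->.
Qed.

End PlaneCurve.

(** * Boundedness and isolation of the double points of a diagram *)

Section DoublePoints.
Variables (K : realType) (D : diagram K).

Definition double_points : set (K * K) :=
  [set z | z.1 <> z.2 /\ phi D z.1 = phi D z.2].

(** Far out the curve is the x-axis, so the partner [b] of a large parameter [a] must lie in
    [-N, N], where the x-coordinate is bounded and cannot reach [a]. *)
Lemma double_points_bounded :
  exists M : K, double_points `<=` `[- M, M] `*` `[- M, M].
Proof.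
have [N NP] := phi_long D; have [sx _] := phi_smooth D.
have /compact_bounded[B [_ BP]] : compact (xcoord (phi D) @` `[- N, N]).
  apply: continuous_compact; last exact: segment_compact.
  by apply: continuous_subspaceT; exact: smooth_continuous.
(* [BP] bounds the x-coordinate on [-N, N] by every number greater than [B], hence the choice of
   [B + 1]. *)
pose M := Num.max (B + 1) N.
have bnd a b : a <> b -> phi D a = phi D b -> `|a| <= M.
  move=> ab phiab; rewrite leNgt; apply/negP; rewrite gt_max => /andP[Ba Na].
  have xb : xcoord (phi D) b = a by rewrite /xcoord -phiab NP.
  have [bN|Nb] := leP `|b| N; last by apply: ab; rewrite -xb /xcoord NP.
  have := BP (B + 1) (ltr_pwDr ltr01 (lexx B)) a; apply/not_implyP; split.
    by exists b => //=; rewrite in_itv /= -ler_norml.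
  by apply/negP; rewrite -ltNge.
exists M => -[a b] [/= ab phiab]; rewrite /= !in_itv /= -!ler_norml.
by split; [exact: (bnd a b)|apply: (bnd b a) => // /esym].
Qed.

(** Three cases: on the diagonal the immersion is locally injective; at a double point
    transversality applies; elsewhere some coordinate separates the two images, and by continuity
    still does so nearby. *)
Lemma double_points_isolated (z : K * K) :
  exists2 U, nbhs z U & finite_set (U `&` double_points).
Proof.
case: z => p q; have [sx sy] := phi_smooth D.
set x := xcoord (phi D) in sx; set y := ycoord (phi D) in sy.
have xy a b : phi D a = phi D b -> x a = x b /\ y a = y b.
  by rewrite /x /y /xcoord /ycoord => ->.
have [<-{q}|/eqP pq] := eqVneq p q.
  have inj f : (forall a b, phi D a = phi D b -> f a = f b) ->
      smooth f -> (f^`())%classic p != 0 ->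
      exists2 U, nbhs (p, p) U & finite_set (U `&` double_points).
    move=> fphi sf f0; have [V pV Vinj] := immersion_locally_injective sf f0.
    exists (V `*` V); first by exists (V, V).
    suff -> : V `*` V `&` double_points = set0 by exact: finite_set0.
    apply/seteqP; split=> // -[a b] [[/= Va Vb] [/= ab /fphi fab]].
    by apply: ab; exact: Vinj.
  have [x0|/inj] := eqVneq (x^`()%classic p) 0; last by apply=> // a b /xy[].
  have [y0|/inj] := eqVneq (y^`()%classic p) 0; last by apply=> // a b /xy[].
  by have := @phi_immersion _ D p; rewrite /vel x0 y0.
have [phipq|phipq] := eqVneq (phi D p) (phi D q).
  have /eqP := phi_transverse pq phipq; rewrite /det2 /=.
  have [xpq ypq] := xy _ _ phipq.
  case/(transverse_isolated sx sy xpq ypq) => U pU UP; exists U => //.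
  apply: (@sub_finite_set _ _ [set (p, q)]); last exact: finite_set1.
  by move=> [a b] [/= /UP Uab [/= _ /xy[]]] /Uab/[apply] -[-> ->].
have sep f : (forall a b, phi D a = phi D b -> f a = f b) ->
    smooth f -> f p != f q ->
    exists2 U, nbhs (p, q) U & finite_set (U `&` double_points).
  move=> fphi /smooth_continuous cf fpq.
  exists [set z | f z.1 - f z.2 != 0]; last first.
    suff -> : [set z | f z.1 - f z.2 != 0] `&` double_points = set0.
      exact: finite_set0.
    apply/seteqP; split=> // -[a b] [/= + [/= _ /fphi fab]].
    by rewrite fab subrr eqxx.
  have cg : (f z.1 - f z.2) @[z --> (p, q)] --> f p - f q.
    apply: cvgB; apply: continuous_comp;
      by [exact: cvg_fst|exact: cvg_snd|exact: cf].
  by apply: cvgr_neq0 cg _; rewrite subr_eq0.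
have [xpq|/sep] := eqVneq (x p) (x q); last by apply=> // a b /xy[].
have [ypq|/sep] := eqVneq (y p) (y q); last by apply=> // a b /xy[].
case/eqP: phipq; rewrite [LHS]surjective_pairing [RHS]surjective_pairing.
by congr (_, _).
Qed.

Lemma cut_finite : finite_set (cut D).
Proof.
have [M MP] := double_points_bounded.
have cK : compact (`[- M, M] `*` `[- M, M] : set (K * K)).
  by apply: compact_setX; exact: segment_compact.
have := compact_isolated_finite cK (fun z _ => double_points_isolated z).
rewrite (setIidr MP) => fin.
apply: (@sub_finite_set _ _ (fst @` double_points)); last exact: finite_image.
move=> r [r' [] /classical_double[rr' phirr']].
  by exists (r, r').
by exists (r, r') => //; split=> //= /esym.
Qed.

End DoublePoints.

(** * Semiarcs and the colouring equations *)

Section Semiarcs.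
Variables (K : realType) (D : diagram K).
Implicit Types (S : semiarc D).

Lemma semiarc_eq S S' : start S = start S' -> stop S = stop S' -> S = S'.
Proof.
case: S => a b ab ha hb hu; case: S' => a' b' ab' ha' hb' hu' /= ? ?; subst.
by congr Semiarc; exact: Prop_irrelevance.
Qed.

(** If the stops differed, the smaller one would be finite, hence a cut inside the other semiarc. *)
Lemma semiarc_eq_start S S' : start S = start S' -> S = S'.
Proof.
have le S1 S2 : start S1 = start S2 -> ~ (stop S1 < stop S2)%E.
  move=> st; have [->|[r cr rE]] := semiarc_stop S1.
    by rewrite ltNge leey.
  rewrite rE => r2; apply: (semiarc_uncut (s := S2) cr).
  by rewrite r2 -st -rE semiarc_lt.
move=> st; apply: semiarc_eq => //; apply/eqP; rewrite eq_le !leNgt.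
by apply/andP; split; apply/negP; exact: le.
Qed.

Lemma semiarc_eq_stop S S' : stop S = stop S' -> S = S'.
Proof.
have le S1 S2 : stop S1 = stop S2 -> ~ (start S2 < start S1)%E.
  move=> st; have [->|[r cr rE]] := semiarc_start S1.
    by rewrite ltNge leNye.
  rewrite rE => r2; apply: (semiarc_uncut (s := S2) cr).
  by rewrite r2 -st -rE semiarc_lt.
move=> st; apply: semiarc_eq => //; apply/eqP; rewrite eq_le !leNgt.
by apply/andP; split; apply/negP; exact: le.
Qed.

Lemma sorted_cut :
  exists2 c : seq K, sorted <%R c & forall r, cut D r <-> r \in c.
Proof.
have /finite_seqP[s sE] := cut_finite D.
exists (sort <=%R (undup s)); first by rewrite sort_lt_sorted undup_uniq.
by move=> r; rewrite mem_sort mem_undup sE.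
Qed.

Variable c : seq K.
Hypotheses (c_sorted : sorted <%R c) (cutE : forall r, cut D r <-> r \in c).

(** The n cuts bound n + 1 semiarcs, numbered from 0 along the line: the cut of index j ends semiarc
    j and starts semiarc j + 1. *)
Definition arc_start i : \bar K := if i is j.+1 then (c`_j)%:E else -oo%E.
Definition arc_stop i : \bar K :=
  if (i < size c)%N then (c`_i)%:E else +oo%E.

Lemma nth_cut i : (i < size c)%N -> cut D c`_i.
Proof. by move=> ic; apply/cutE; exact: mem_nth. Qed.

Lemma arc_exists i : exists S, (i <= size c)%N ->
  start S = arc_start i /\ stop S = arc_stop i.
Proof.
have arcP j : (j <= size c)%N ->
    exists S, start S = arc_start j /\ stop S = arc_stop j.
  move=> jc; have lt : (arc_start j < arc_stop j)%E.
    rewrite /arc_start /arc_stop; case: j jc => [|j] jc.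
      by case: ifP => _; rewrite ?ltNyr.
    case: ifP => [jc'|_]; last by rewrite ltry.
    by rewrite lte_fin lt_sorted_ltn_nth ?inE//.
  have st : arc_start j = -oo%E \/ exists2 r, cut D r & arc_start j = r%:E.
    case: j jc {lt} => [|j] jc; [by left|right].
    by exists c`_j => //; exact: nth_cut.
  have sp : arc_stop j = +oo%E \/ exists2 r, cut D r & arc_stop j = r%:E.
    rewrite /arc_stop; case: ifP => jc'; [right|by left].
    by exists c`_j => //; exact: nth_cut.
  (* A cut of index [k] strictly inside would satisfy j - 1 < k < j. *)
  have un r : cut D r -> ~ (arc_start j < r%:E < arc_stop j)%E.
    move=> /cutE rc; rewrite -(nth_index 0 rc).
    have: (index r c < size c)%N by rewrite index_mem.
    move: (index r c) => k kc /andP[].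
    have nth_lt a b : (a < size c)%N -> (b < size c)%N ->
        (c`_a < c`_b) = (a < b)%N.
      by move=> ac bc; rewrite lt_sorted_ltn_nth ?inE.
    rewrite /arc_stop; case: ifP => [jc'|jc'].
      rewrite lte_fin nth_lt// => jk kj; move: jk.
      case: j kj jc jc' {lt st sp} => [//|j] kj jc jc'.
      by rewrite /= lte_fin nth_lt// ltnNge -ltnS kj.
    have jE : j = size c by apply/eqP; rewrite eqn_leq jc leqNgt jc'.
    case: j jE jc jc' {lt st sp} => [|j] jE jc jc'.
      by move: kc; rewrite -jE.
    by rewrite /= lte_fin nth_lt// ltnNge -ltnS jE kc.
  by exists (Semiarc lt st sp un).
have [ic|ic] := leqP i (size c).
  by have [S SP] := arcP _ ic; exists S.
(* Beyond the range any semiarc serves as default value; the first one is taken. *)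
by have [S _] := arcP 0%N (leq0n _); exists S.
Qed.

Definition arc i : semiarc D := projT1 (cid (arc_exists i)).

Lemma start_arc i : (i <= size c)%N -> start (arc i) = arc_start i.
Proof. by rewrite /arc; case: cid => S /= SP /SP[]. Qed.

Lemma stop_arc i : (i <= size c)%N -> stop (arc i) = arc_stop i.
Proof. by rewrite /arc; case: cid => S /= SP /SP[]. Qed.

Definition arc_index S : nat :=
  if stop S is r%:E then index r c else size c.

Lemma arc_index_le S : (arc_index S <= size c)%N.
Proof. by rewrite /arc_index; case: stop => // r; exact: index_size. Qed.

Lemma arc_indexK : cancel arc_index arc.
Proof.
move=> S; apply: semiarc_eq_stop; rewrite stop_arc ?arc_index_le//.
rewrite /arc_index /arc_stop; have [->|[r /cutE rc ->]] := semiarc_stop S.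
  by rewrite ltnn.
by rewrite index_mem rc nth_index.
Qed.

Lemma arcK i : (i <= size c)%N -> arc_index (arc i) = i.
Proof.
move=> ic; rewrite /arc_index stop_arc// /arc_stop; case: ifP => ic'.
  by rewrite index_uniq// (sorted_uniq lt_trans)//; exact: ltxx.
by apply/eqP; rewrite eqn_leq ic leqNgt ic'.
Qed.

Lemma start_arcP S i : (i < size c)%N -> start S = (c`_i)%:E -> S = arc i.+1.
Proof. by move=> ic Si; apply: semiarc_eq_start; rewrite start_arc. Qed.

Lemma stop_arcP S i : (i < size c)%N -> stop S = (c`_i)%:E -> S = arc i.
Proof.
move=> ic Si; apply: semiarc_eq_stop.
by rewrite (stop_arc (ltnW ic)) /arc_stop ic.
Qed.

(** * Colourings as equations between numbered colours *)

Section Equations.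
Variables (A : Type) (unop ovop : A -> A -> A).

(** Here [i] and [k] index the over- and the underpassage, so the incoming semiarcs are [i], [k] and
    the outgoing ones [i.+1], [k.+1]. *)
Definition crossing_equations (x : nat -> A) (i k : nat) :=
  if `[< positive D c`_i c`_k >]
  then x i = ovop (x i.+1) (x k) /\ x k.+1 = unop (x k) (x i.+1)
  else x i.+1 = ovop (x i) (x k.+1) /\ x k = unop (x k.+1) (x i).

(** The four semiarcs provided by [is_coloring] are determined by their ends at the crossing. *)
Lemma is_coloringP (C : semiarc D -> A) : is_coloring unop ovop C <->
  forall i k, (i < size c)%N -> (k < size c)%N -> classical D c`_i c`_k ->
    crossing_equations (C \o arc) i k.
Proof.
split=> [CP i k ic kc /CP[oi [oo [ui [uo]]]]|CP o v ov].
  move=> [/(stop_arcP ic)-> /(start_arcP ic)-> /(stop_arcP kc)->].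
  by move=> /(start_arcP kc)->.
have oc : o \in c by apply/cutE; exists v; left.
have vc : v \in c by apply/cutE; exists o; right.
have := CP (index o c) (index v c).
rewrite !index_mem /crossing_equations !nth_index// => /(_ oc vc ov) /= eqs.
exists (arc (index o c)), (arc (index o c).+1).
exists (arc (index v c)), (arc (index v c).+1).
by rewrite !stop_arc ?start_arc ?index_size ?index_mem// /arc_stop /=
  !index_mem oc vc !nth_index.
Qed.

End Equations.

(** As there are no triple points, a cut belongs to a single crossing and plays a single role there;
    this and the next two lemmas cover the possible coincidences. *)
Lemma classical_over_uniq o v v' :
  classical D o v -> classical D o v' -> v = v'.
Proof.
move=> /classical_double[ov eov] /classical_double[ov' eov'].
by have [/esym|/ov'|] := phi_double (esym eov) eov'.
Qed.

Lemma classical_under_uniq o o' v :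
  classical D o v -> classical D o' v -> o = o'.
Proof.
move=> /classical_double[ov eov] /classical_double[ov' eov'].
by have [/ov|/esym|] := phi_double eov (esym eov').
Qed.

Lemma classical_over_not_under r v o : classical D r v -> ~ classical D o r.
Proof.
move=> rv or; have [rv' erv] := classical_double rv.
have [or' eor] := classical_double or.
have [/or'|/rv'|ov] := phi_double eor erv => //; subst o.
exact: classical_asym rv or.
Qed.

(** * The linear system of a diagram *)

Definition over_equation (x : nat -> X) (i k : nat) :=
  if `[< positive D c`_i c`_k >]
  then x i = over_op (x i.+1) (x k) else x i.+1 = over_op (x i) (x k.+1).

Definition under_equation (x : nat -> X) (i k : nat) :=
  if `[< positive D c`_i c`_k >]
  then x k.+1 = under_op (x k) (x i.+1) else x k = under_op (x k.+1) (x i).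

(** The two equations of a crossing are shared between its two passages. Each cut then carries just
    one equation, which serves to express the colour right after it. *)
Definition passage_equations (x : nat -> X) (j : nat) :=
  (forall k, (k < size c)%N -> classical D c`_j c`_k -> over_equation x j k) /\
  (forall i, (i < size c)%N -> classical D c`_i c`_j -> under_equation x i j).

Lemma is_coloring_passages (C : semiarc D -> X) :
  is_coloring under_op over_op C <->
  forall j, (j < size c)%N -> passage_equations (C \o arc) j.
Proof.
rewrite is_coloringP; split=> [eqs j jc|eqs i k ic kc cik].
  split=> [k kc /(eqs _ _ jc kc)|i ic /(eqs _ _ ic jc)];
    by rewrite /crossing_equations /over_equation /under_equation;
      case: ifP => _ [].
have [/(_ k kc cik) + _] := eqs i ic; have [_ /(_ i ic cik)] := eqs k kc.
by rewrite /crossing_equations /over_equation /under_equation; case: ifP.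
Qed.

(** The entries are added because the columns [j], [k1], [k2] may coincide. *)
Definition sparse_row (s : X) j (e1 : X) k1 (e2 : X) k2 (k : nat) : X :=
  s *+ (k == j) + e1 *+ (k == k1) + e2 *+ (k == k2).

Lemma sum_sparse_row n s j e1 k1 e2 k2 (x : nat -> X) :
  (j < n)%N -> (k1 < n)%N -> (k2 < n)%N ->
  \sum_(k < n) sparse_row s j e1 k1 e2 k2 k * x k =
  s * x j + e1 * x k1 + e2 * x k2.
Proof.
have delta (a : X) i : (i < n)%N ->
    \sum_(k < n) a *+ (k == i :> nat) * x k = a * x i.
  move=> i_n; rewrite (bigD1 (Ordinal i_n))//= eqxx mulr1n big1 ?addr0// => k.
  by rewrite -val_eqE /= => /negPf ->; rewrite mul0r.
move=> jn k1n k2n; rewrite -!delta// -!big_split; apply: eq_bigr => k _ /=.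
by rewrite !mulrDl.
Qed.

Lemma aug_sparse_row s j e1 k1 e2 k2 k : aug e1 -> aug e2 -> (j < k)%N ->
  aug (sparse_row s j e1 k1 e2 k2 k).
Proof.
move=> a1 a2 jk; rewrite /sparse_row gtn_eqF// add0r.
have [a0 augn] : aug 0 /\ forall e (b : bool), aug e -> aug (e *+ b).
  have a0 := ideal0 ideal_aug; split=> // e [] ae; by rewrite ?mulr1n.
by apply: (idealD ideal_aug); exact: augn.
Qed.

(** In all four cases (over or under, positive or negative) the only coefficient that may lie
    outside [aug] is that of [x j]; columns after [j], including [j.+1] itself, get coefficients in
    [aug]. *)
Lemma passage_row j : (j < size c)%N -> exists M : nat -> X,
  (forall k, (j < k)%N -> aug (M k)) /\
  forall x, passage_equations x j <->
    x j.+1 = \sum_(k < (size c).+1) M k * x k.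
Proof.
move=> jc.
have rowP s e1 k1 e2 k2 : aug e1 -> aug e2 -> (k1 <= size c)%N ->
    (k2 <= size c)%N -> (forall x, passage_equations x j <->
      x j.+1 = s * x j + e1 * x k1 + e2 * x k2) ->
    exists M : nat -> X, (forall k, (j < k)%N -> aug (M k)) /\
      forall x, passage_equations x j <->
        x j.+1 = \sum_(k < (size c).+1) M k * x k.
  move=> a1 a2 k1c k2c eqP; exists (sparse_row s j e1 k1 e2 k2).
  split=> [k|x]; first exact: aug_sparse_row.
  by rewrite sum_sparse_row// ltnW.
have c_uniq : uniq c.
  by apply: sorted_uniq c_sorted; [exact: lt_trans|exact: ltxx].
have nth_inj a b : (a < size c)%N -> (b < size c)%N -> c`_a = c`_b -> a = b.
  by move=> ac bc /eqP; rewrite nth_uniq// => /eqP.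
have aug0 : aug 0 := ideal0 ideal_aug.
have augN := idealN ideal_aug.
have augMl := idealMl ideal_aug.
have augut : aug (Xu + Xt) := idealD ideal_aug aug_u aug_t.
have passage r : cut D r ->
    exists2 r', cut D r' & classical D r r' \/ classical D r' r.
  by move=> [r' h]; exists r' => //; exists r; case: h; [right|left].
have [r' /cutE r'c] := passage _ (nth_cut jc).
rewrite -(nth_index 0 r'c); have: (index r' c < size c)%N by rewrite index_mem.
move: (index r' c) => k kc [cjk|ckj].
- have over x : passage_equations x j <-> over_equation x j k.
    split=> [[/(_ k kc cjk)]//|eqn]; split=> [k' k'c cjk'|i ic cij].
      by rewrite -(nth_inj _ _ kc k'c (classical_over_uniq cjk cjk')).
    by case: (classical_over_not_under cjk cij).
  have [pos|neg] := boolP `[< positive D c`_j c`_k >].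
    apply: (rowP Xs Xu j.+1 Xt k) => //.
    - exact: aug_u.
    - exact: aug_t.
    - exact: ltnW.
    by move=> x; rewrite over /over_equation pos over_opP.
  (* Only two terms occur here; the coefficient 0 in column [j] fills the third place, as in the
     under cases below. *)
  apply: (rowP (Xsi * (1 - Xu)) 0 j (- (Xsi * Xt)) k.+1) => //.
  - by apply: augN; apply: augMl; exact: aug_t.
  - exact: ltnW.
  by move=> x; rewrite over /over_equation (negPf neg) mul0r addr0 mulNr.
- have under x : passage_equations x j <-> under_equation x k j.
    split=> [[_ /(_ k kc ckj)]//|eqn]; split=> [i ic cji|k' k'c ck'j].
      by case: (classical_over_not_under cji ckj).
    by rewrite -(nth_inj _ _ kc k'c (classical_under_uniq ckj ck'j)).
  have [pos|neg] := boolP `[< positive D c`_k c`_j >].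
    apply: (rowP Xsi 0 j (- (Xsi * (Xu + Xt))) k.+1) => //.
    - by apply: augN; exact: augMl.
    - exact: ltnW.
    by move=> x; rewrite under /under_equation pos mul0r addr0 mulNr.
  apply: (rowP Xs 0 j (Xu + Xt) k) => //; [exact: ltnW|exact: ltnW|].
  by move=> x; rewrite under /under_equation (negPf neg) mul0r addr0 under_opP.
Qed.

Lemma coloring_system : exists M : nat -> nat -> X,
  (forall i k, (i <= k)%N -> aug (M i k)) /\
  forall (a : X) (C : semiarc D -> X),
    is_coloring under_op over_op C /\ initial_color C a <->
    solution (size c).+1 M (fun i => a *+ (i == 0%N)) (C \o arc).
Proof.
have /choice[M MP] : forall j, exists M : nat -> X, (j < size c)%N ->
    (forall k, (j < k)%N -> aug (M k)) /\
    forall x, passage_equations x j <->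
      x j.+1 = \sum_(k < (size c).+1) M k * x k.
  move=> j; have [jc|jc] := ltnP j (size c); last by exists (fun=> 0).
  by have [M MP] := passage_row jc; exists M.
(* Row j + 1 is the equation of passage j, so columns beyond j become those on or above the
   diagonal. Row 0 is zero and leaves the initial condition; rows out of range are zero too. *)
pose N i k := if i is j.+1 then if (j < size c)%N then M j k else 0 else 0.
exists N; split=> [[|i] k ik|a C].
- exact: ideal0 ideal_aug.
- rewrite /N; case: ifP => [ic|_]; last exact: ideal0 ideal_aug.
  by have [augM _] := MP _ ic; exact: augM.
have initE : initial_color C a <-> C (arc 0) = a.
  split=> [[S S0 <-]|C0]; last by exists (arc 0); rewrite ?start_arc.
  by congr C; apply: semiarc_eq_start; rewrite start_arc.
rewrite is_coloring_passages initE; split=> [[eqs C0] [|j]|sol].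
- by move=> _; rewrite /= C0 mulr1n big1 ?addr0// => k _; rewrite mul0r.
- rewrite ltnS => jc; have [_ /(_ (C \o arc)) MPj] := MP _ jc.
  by rewrite /= mulr0n add0r jc; apply/MPj; exact: eqs.
split=> [j jc|].
  have [_ /(_ (C \o arc)) MPj] := MP _ jc; apply/MPj.
  by rewrite (sol j.+1)// mulr0n add0r /= jc.
have /= -> := sol 0%N (ltn0Sn _).
by rewrite mulr1n big1 ?addr0// => k _; rewrite mul0r.
Qed.

End Semiarcs.

(** * Existence, uniqueness and the terminal colour *)

Theorem theorem4p1 (K : realType) (D : diagram K) :
  (forall a : X, exists! C : semiarc D -> X,
     is_coloring under_op over_op C /\ initial_color C a) /\
  (exists F : X, forall (a : X) (C : semiarc D -> X),
     is_coloring under_op over_op C -> initial_color C a ->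
     terminal_color C (F * a)).
Proof.
have [c c_sorted cutE] := sorted_cut D.
have [M [augM systemE]] := coloring_system c_sorted cutE.
pose b a := fun i : nat => a *+ (i == 0%N) : X.
have solve a := @solution_unique_exists _ _ ideal_aug quasi_regular_aug
  (size c).+1 M (b a) (fun i j ij => augM i j (proj1 (andP ij))).
split=> [a|].
- have [[x xP] uniq] := solve a; exists (x \o arc_index c); split.
    apply/systemE; apply: eq_solution xP => i.
    by rewrite ltnS => ic /=; rewrite arcK.
  move=> C /systemE CP; apply/funext => S /=.
  rewrite -[in RHS](arc_indexK c_sorted cutE S).
  by apply: (uniq _ _ xP CP); rewrite ltnS; exact: arc_index_le.
(* The witness is the colour of the last semiarc, of index [size c], in the solution with initial
   colour 1. *)
- have [[x xP] _] := solve 1; exists (x (size c)) => a C Ccol Cinit.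
  have /systemE CP := conj Ccol Cinit.
  exists (arc c_sorted cutE (size c)).
    by rewrite stop_arc// /arc_stop ltnn.
  have [_ uniq] := solve a.
  (* The solution for 1 times [a] on the right solves the system for [a], so it agrees with [C]. *)
  apply: (uniq _ (fun i => x i * a) CP) => // i i_n.
  by rewrite (solutionMr a xP)// /b mulrnAl mul1r.
Qed.
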